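(* Let $G$ be a connected graph of order $n(G)$. Then $\gamma_e(G)\leq \frac{43}{108}(n(G)+2)$, where $\gamma_e(G)$ is the exponential domination number of $G$.
   Context: All graphs are finite, simple, and undirected. Let $G$ be a graph and $S\subseteq V(G)$. For two vertices $u,v$ of $G$ with $u\in S$ or $v\in S$, let $\mathrm{dist}_{(G,S)}(u,v)$ be the minimum number of edges of a path $P$ in $G$ between $u$ and $v$ such that $S$ contains exactly one endvertex of $P$ and no internal vertex of $P$; if no such path exists, $\mathrm{dist}_{(G,S)}(u,v)=\infty$. (Thus $\mathrm{dist}_{(G,S)}(u,u)=0$ for $u\in S$, and $\mathrm{dist}_{(G,S)}(u,v)=\infty$ for distinct $u,v\in S$.) For a vertex $u$ of $G$, let $$w_{(G,S)}(u)=\sum_{v\in S}\left(\tfrac12\right)^{\mathrm{dist}_{(G,S)}(u,v)-1},\qquad \left(\tfrac12\right)^{\infty}=0,$$ so that $w_{(G,S)}(u)=2$ for $u\in S$. The set $S$ is an exponential dominating set of $G$ if $w_{(G,S)}(u)\geq 1$ for every vertex $u$ of $G$. The exponential domination number $\gamma_e(G)$ is the minimum order of an exponential dominating set of $G$. *)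

(* Defs.v *)
(* A finite simple graph is a symmetric irreflexive relation e on a finType T;
   T is its vertex set and #|T| its order.  *)
From mathcomp Require Import all_boot all_order all_algebra.

Set Implicit Arguments.
Unset Strict Implicit.
Unset Printing Implicit Defensive.

Import Order.TTheory GRing.Theory Num.Theory.

Local Open Scope ring_scope.

Definition connected_graph (T : finType) (e : rel T) : Prop :=
  forall u v : T, connect e u v.

(* The path has vertex sequence u :: p, so it has size p edges.  Its set of
   endvertices is [set u; v] (a singleton when u = v), and its internal
   vertices are those of u :: p without the first and the last one. *)
Definition dist_path (T : finType) (e : rel T) (S : {set T}) (u v : T)
    (p : seq T) : bool :=
  [&& path e u p, last u p == v, uniq (u :: p),
      #|S :&: [set u; v]| == 1%N
    & all (fun x => x \notin S) (behead (belast u p))].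

(* None stands for infinity.  Only lengths below #|T| are searched, since a
   path has no repeated vertex; see distP. *)
Definition dist (T : finType) (e : rel T) (S : {set T}) (u v : T) :
    option nat :=
  ohead [seq k <- iota 0 #|T| | [exists p : k.-tuple T, dist_path e S u v p]].

Definition half_pow (d : option nat) : rat :=
  if d is Some k then (1 / 2) ^ (k%:Z - 1) else 0.

Definition exp_weight (T : finType) (e : rel T) (S : {set T}) (u : T) : rat :=
  \sum_(v in S) half_pow (dist e S u v).

Definition exp_dominating (T : finType) (e : rel T) (S : {set T}) : bool :=
  [forall u : T, 1 <= exp_weight e S u].

(* The full vertex set is always exponentially dominating (exp_dominatingT),
   so this is a genuine minimum; see exp_dom_numberP. *)
Definition exp_dom_number (T : finType) (e : rel T) : nat :=
  #|[arg min_(S < [set: T] | exp_dominating e S) #|S|]|.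

Lemma dist_path_size (T : finType) (e : rel T) (S : {set T}) (u v : T)
    (p : seq T) :
  dist_path e S u v p -> (size p < #|T|)%N.
Proof.
case/and5P=> _ _ Up _ _.
by rewrite -[(size p).+1]/(size (u :: p)) -(card_uniqP Up) max_card.
Qed.

Lemma distP (T : finType) (e : rel T) (S : {set T}) (u v : T) :
  match dist e S u v with
  | Some k => (exists2 p, dist_path e S u v p & size p = k)
              /\ forall p, dist_path e S u v p -> (k <= size p)%N
  | None => forall p, ~~ dist_path e S u v p
  end.
Proof.
rewrite /dist; set a := fun k : nat => _; set s := [seq k <- _ | _].
have mem_s p : dist_path e S u v p -> size p \in s.
  move=> Hp; rewrite mem_filter mem_iota /= add0n (dist_path_size Hp) andbT.
  by apply/existsP; exists (in_tuple p).
have ss : sorted leq s by apply: sorted_filter (iota_sorted _ _); apply: leq_trans.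
have sa k : k \in s -> exists2 p, dist_path e S u v p & size p = k.
  by rewrite mem_filter => /andP[/existsP[p Hp] _]; exists p; rewrite ?size_tuple.
case: s mem_s ss sa => [|k s] /= mem_s ss sa.
  by move=> p; apply/negP => /mem_s.
split; first by apply: sa; rewrite mem_head.
move=> p /mem_s; rewrite inE => /predU1P[-> //|].
by move: ss; rewrite path_sortedE; [case/andP=> /allP H _ /H | apply: leq_trans].
Qed.

Lemma dist_self (T : finType) (e : rel T) (S : {set T}) (u : T) :
  u \in S -> dist e S u u = Some 0%N.
Proof.
move=> uS; have H : dist_path e S u u [::].
  by rewrite /dist_path /= eqxx setUid (setIidPr _) ?sub1set ?cards1.
have := distP e S u u; case: dist => [k [_ /(_ _ H)]|/(_ [::])]; last by rewrite H.
by rewrite leqn0 => /eqP->.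
Qed.

Lemma half_pow_ge0 (d : option nat) : 0 <= half_pow d.
Proof. by case: d => //= k; apply: exprz_ge0. Qed.

Lemma dist_in (T : finType) (e : rel T) (S : {set T}) (u v : T) :
  u \in S -> v \in S -> u != v -> dist e S u v = None.
Proof.
move=> uS vS uv; have := distP e S u v; case: dist => // k [[p + _] _].
case/and5P=> _ _ _; rewrite (setIidPr _) ?cards2 ?uv //.
by apply/subsetP=> x; rewrite !inE => /orP[] /eqP->.
Qed.

Lemma exp_weight_in (T : finType) (e : rel T) (S : {set T}) (u : T) :
  u \in S -> exp_weight e S u = 2.
Proof.
move=> uS; rewrite /exp_weight (bigD1 u) //= dist_self //= big1 ?addr0 //.
by move=> v /andP[vS vu]; rewrite dist_in // eq_sym.
Qed.

Lemma exp_dominatingT (T : finType) (e : rel T) : exp_dominating e [set: T].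
Proof. by apply/forallP=> u; rewrite exp_weight_in ?inE. Qed.

Lemma exp_dom_numberP (T : finType) (e : rel T) :
  (exists2 S : {set T}, exp_dominating e S & #|S| = exp_dom_number e)
  /\ forall S : {set T}, exp_dominating e S -> (exp_dom_number e <= #|S|)%N.
Proof.
rewrite /exp_dom_number; case: arg_minnP => [|S HS min_S].
  exact: exp_dominatingT.
by split=> //; exists S.
Qed.

(* Main.v *)
(* Weights only grow when edges are added, so work along a rooted spanning
   tree, built by repeatedly hanging one rooted tree below the root of
   another. What a partial solution S in a rooted tree does for the rest of
   the graph is recorded by two numbers: the weight s it delivers at the
   root, and the weight n it still needs to receive at the root from outside.
   Attaching a subtree (s', n') below a root (s, n) gives (s + s'/2, max (n -
   s'/2, 2 n' - s)), since weights halve along the connecting edge. Measuring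
   the cost of S by 108 |S| - 43 |V|, every rooted tree admits all the
   partial solutions of one of finitely many profiles, because these profiles
   are closed under attachment up to weakening. Each profile contains a
   solution with n = 0 and cost at most 86 = 2 * 43, which is the bound. *)
From HB Require Import structures.
Require Import Defs.
From mathcomp Require Import all_boot all_order all_algebra zify lra.

Set Implicit Arguments.
Unset Strict Implicit.
Unset Printing Implicit Defensive.

Import Order.TTheory GRing.Theory Num.Theory.
Local Open Scope ring_scope.

(** * Comparing distances in two graphs *)

(** If every path can be rerouted with at most [m] extra edges, the distance grows by at most [m],
    so the contribution of [v] loses at most a factor [2^m]; an infinite distance contributes 0. *)
Lemma half_pow_dist_le (T : finType) (e1 e2 : rel T) (S1 S2 : {set T})
    (u1 u2 v : T) (m : nat) :
  (forall p, dist_path e1 S1 u1 v p ->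
     exists2 q, dist_path e2 S2 u2 v q & (size q <= m + size p)%N) ->
  (1 / 2) ^+ m * half_pow (dist e1 S1 u1 v) <= half_pow (dist e2 S2 u2 v).
Proof.
move=> H; have := distP e1 S1 u1 v.
case: dist => [k [[p /H [q Hq le_q] szp] _]|_]; last first.
  by rewrite mulr0 half_pow_ge0.
have := distP e2 S2 u2 v.
case: dist => [j [_ /(_ _ Hq) le_j]|/(_ q)]; last by rewrite Hq.
have le_jk : (j <= m + k)%N by rewrite -szp (leq_trans le_j).
have half0 : (1 / 2 : rat) != 0 by [].
have eq_exp : m%:Z + (k%:Z - 1) = (m + k - j)%N%:Z + (j%:Z - 1) by lia.
rewrite /= exprnP -expfzDr // eq_exp expfzDr //.
by rewrite ler_piMl ?exprz_ge0 ?exprn_ile1.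
Qed.

(** A path from an unselected to a selected vertex meets [S] only at its end, so the conditions on
    [S] collapse to one on [belast]. *)
Lemma dist_path_outE (T : finType) (e : rel T) (S : {set T}) (u v : T)
    (p : seq T) : u \notin S -> v \in S ->
  dist_path e S u v p =
  [&& path e u p, last u p == v, uniq (u :: p)
    & all (fun x => x \notin S) (belast u p)].
Proof.
move=> uS vS; rewrite /dist_path.
have -> : S :&: [set u; v] = [set v].
  apply/setP=> x; rewrite !inE; have [->|_] := eqVneq x u.
    by rewrite (negPf uS); case: eqVneq uS vS => [->|] // /negPf->.
  by case: eqVneq => [->|_]; rewrite ?vS ?andbF.
rewrite cards1 /=.
case: p => [|x p]; rewrite /= ?uS //.
Qed.

(** This also covers a selected [u]: then [u = v] and the path is empty. *)
Lemma dist_path_belast (T : finType) (e : rel T) (S : {set T}) (u v : T)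
    (p : seq T) : v \in S -> dist_path e S u v p ->
  all (fun x => x \notin S) (belast u p).
Proof.
move=> vS; have [uS|uS] := boolP (u \in S); last first.
  by rewrite dist_path_outE // => /and4P[].
case/and5P=> _ /eqP lp Up + _; rewrite (setIidPr _); last first.
  by apply/subsetP=> x; rewrite !inE => /orP[] /eqP->.
rewrite cards2; have [uv _|//] := eqVneq u v.
by case: p lp Up => //= x p; rewrite -uv => <-; rewrite mem_last.
Qed.

(** Bookkeeping of demand: of the [x / 2] requested at a root, [y / 2] arrives over the joining edge
    and [z / 2] remains; [k] is the length of the escape path. *)
Lemma discount_transfer (w w' x y z : rat) (k : nat) :
  1 <= w + x / 2 * (1 / 2) ^+ k -> w + (1 / 2) ^+ k.+1 * y <= w' ->
  x <= z + y -> 1 <= w' + z / 2 * (1 / 2) ^+ k.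
Proof.
rewrite exprS; have : 0 <= (1 / 2 : rat) ^+ k by apply: exprn_ge0.
move: (_ ^+ k) => h h0 wx wy xyz; have := ler_wpM2r h0 xyz; lra.
Qed.

(** * Root states and the finite table of profiles *)

(* Sel: the root is selected.  Uns s n: the root is not selected, receives
   weight at least s/2 from its own tree and needs weight n/2 from outside.
   join_state rounds down to stay on this grid. *)
Variant state := Sel | Uns of nat & nat.

Definition state_code (a : state) : option (nat * nat) :=
  if a is Uns s n then Some (s, n) else None.

Definition state_decode (x : option (nat * nat)) : state :=
  if x is Some (s, n) then Uns s n else Sel.

Lemma state_codeK : cancel state_code state_decode.
Proof. by case. Qed.

HB.instance Definition _ := Equality.copy state (can_type state_codeK).

Definition better (a b : state) : bool :=
  match a, b with
  | Sel, Sel => true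
  | Uns s n, Uns s' n' => (s' <= s)%N && (n <= n')%N
  | _, _ => false
  end.

(** A selected root sends weight 1, that is 2 units, over the edge and blocks all other help, so a
    child needing more gives [None]. *)
Definition join_state (a b : state) : option state :=
  match a, b with
  | Sel, Sel => Some Sel
  | Sel, Uns _ n => if (n <= 2)%N then Some Sel else None
  | Uns s n, Sel => Some (Uns (s + 2) (n - 2))
  | Uns s n, Uns s' n' =>
      Some (Uns (s + s'./2) (maxn (n - s'./2) (2 * n' - s)))
  end.

(* An option (a, k) stands for a partial solution of state a and cost at most k
   (see realizes). *)
Definition option_le (o o' : state * int) : bool :=
  better o.1 o'.1 && (o.2 <= o'.2).

Definition profile_le (P Q : seq (state * int)) : bool :=
  all (fun q => has (fun p => option_le p q) P) Q.

Definition join_option (o o' : state * int) : option (state * int) :=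
  omap (pair^~ (o.2 + o'.2)) (join_state o.1 o'.1).

Definition join_profile (P Q : seq (state * int)) : seq (state * int) :=
  pmap (fun x => join_option x.1 x.2) [seq (o, o') | o <- P, o' <- Q].

(** Here [65 = 108 - 43]; an unselected vertex needs weight 1, which is 2 units. *)
Definition point_profile : seq (state * int) := [:: (Sel, 65); (Uns 0 2, -43)].

(* Found by a computer search: the closure of point_profile under join_profile,
   then thinned by greedily weakening and merging profiles. *)
Definition profiles : seq (seq (state * int)) :=
  [:: [:: (Sel, 65); (Uns 0 2, -43)];
      [:: (Sel, 22); (Uns 0 4, -84)];
      [:: (Uns 0 2, -43); (Uns 4 0, 65)];
      [:: (Uns 0 3, -45); (Uns 6 0, 41)];
      [:: (Uns 0 4, -66); (Uns 4 0, 22)];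
      [:: (Uns 0 4, -50); (Uns 6 0, 23)];
      [:: (Uns 0 6, -88); (Uns 3 0, 0)];
      [:: (Uns 0 6, -68); (Uns 4 0, 1)];
      [:: (Uns 0 6, -55); (Uns 5 0, 5)];
      [:: (Uns 2 1, -21); (Uns 0 0, 86)];
      [:: (Uns 3 0, -18)];
      [:: (Uns 4 0, -5)];
      [:: (Uns 6 0, 0)]].

(** The inductive step over rooted trees, reduced to a finite check on pairs of profiles. *)
Lemma profiles_closed :
  all (fun P => all (fun Q =>
    has (fun R => profile_le (join_profile P Q) R) profiles) profiles) profiles.
Proof. by vm_compute. Qed.

Definition dominating_option (o : state * int) : bool :=
  (if o.1 is Uns _ n then n == 0%N else true) && (o.2 <= 86).

Lemma profiles_final : all (has dominating_option) profiles.
Proof. by vm_compute. Qed.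

(** * Weights inside a vertex subset *)

Section Restriction.

Variables (T : finType) (e : rel T).

(** Kept as a relation on [T], so that sets and paths of different pieces share one vertex type. *)
Definition restrict (V : {set T}) : rel T :=
  fun x y => [&& x \in V, y \in V & e x y].

Definition weight (V S : {set T}) (u : T) := exp_weight (restrict V) S u.

(** Outside weight enters at the root [r] and can reach [u] only through unselected vertices; these
    paths carry it. *)
Definition escape (V S : {set T}) (u r : T) (p : seq T) : bool :=
  [&& path (restrict V) u p, last u p == r, uniq (u :: p)
    & all (fun x => x \in V :\: S) (u :: p)].

Lemma weight_ge0 (V S : {set T}) (u : T) : 0 <= weight V S u.
Proof. by apply: sumr_ge0 => v _; apply: half_pow_ge0. Qed.

Lemma path_restrict (A V : {set T}) (u : T) (p : seq T) :
  A \subset V -> path (restrict A) u p -> path (restrict V) u p.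
Proof.
move=> sAV; apply: sub_path => x y /and3P[xA yA exy].
by rewrite /restrict !(subsetP sAV).
Qed.

Lemma path_restrict_sub (V : {set T}) (u : T) (p : seq T) :
  path (restrict V) u p -> u \in V -> {subset u :: p <= V}.
Proof.
elim: p u => [|x p IH] u /=; first by move=> _ uV y; rewrite inE => /eqP->.
case/andP=> /and3P[_ xV _] /IH /(_ xV) sub uV y.
by rewrite inE => /predU1P[->|/sub].
Qed.

(** * Joining two disjoint pieces along an edge *)

Section Join.

Variables (A B SA SB : {set T}) (r c : T).
Hypotheses (disAB : [disjoint A & B]) (sA : SA \subset A) (sB : SB \subset B).
Hypotheses (rA : r \in A) (cB : c \in B) (erc : e r c).

Lemma notin_join (x : T) : x \in A -> x \notin SA -> x \notin SA :|: SB.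
Proof.
move=> xA xS; rewrite inE (negPf xS) /=.
by apply: contraTN xA => /(subsetP sB) xB; rewrite (disjointFl disAB).
Qed.

Lemma join_dist_path (u v : T) (p : seq T) :
  u \in A -> u \notin SA -> v \in SA ->
  dist_path (restrict A) SA u v p ->
  dist_path (restrict (A :|: B)) (SA :|: SB) u v p.
Proof.
move=> uA uS vS; rewrite !dist_path_outE ?notin_join ?inE ?vS //.
case/and4P=> Pp -> Up aS; rewrite Up (path_restrict (subsetUl A B) Pp) /=.
apply/allP=> x xp; apply: notin_join; last exact: (allP aS).
by apply: (path_restrict_sub Pp) => //; apply: mem_belast.
Qed.

(** Follow the escape path, cross the edge, continue along [q]; disjointness keeps the result simple
    and unselected before [v]. *)
Lemma join_dist_path_cross (u v : T) (p q : seq T) :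
  u \in A -> u \notin SA -> v \in SB -> escape A SA u r p ->
  dist_path (restrict B) SB c v q ->
  exists2 q', dist_path (restrict (A :|: B)) (SA :|: SB) u v q'
    & (size q' <= (size p).+1 + size q)%N.
Proof.
move=> uA uS vS /and4P[Pp /eqP lp Up /allP aS] dq.
(* The vertex [c] may itself be selected, in which case [q] is empty. *)
have bS := allP (dist_path_belast vS dq).
case/and5P: dq => Pq /eqP lq Uq _ _.
have qB := path_restrict_sub Pq cB.
have pA x : x \in u :: p -> x \in A by move=> /aS /setDP[].
exists (p ++ c :: q); last by rewrite size_cat /= addnS addSn.
have Upq : uniq (u :: p ++ c :: q).
  rewrite -cat_cons cat_uniq Up Uq andbT.
  apply/hasPn=> x /qB xB; apply/negP=> /pA xA.
  by rewrite (disjointFr disAB xA) in xB.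
rewrite dist_path_outE ?notin_join ?inE ?vS ?orbT //.
rewrite Upq cat_path lp (path_restrict (subsetUl A B) Pp) /=.
rewrite (path_restrict (subsetUr A B) Pq) /restrict !inE rA cB orbT erc /=.
rewrite last_cat /= lq eqxx /=.
rewrite belast_cat lp all_cat /=.
apply/and3P; split.
- apply/allP=> x /mem_belast xp; case/setDP: (aS x xp); exact: notin_join.
- by rewrite -lp; case/setDP: (aS _ (mem_last u p)); exact: notin_join.
- apply/allP=> x xq; rewrite inE negb_or bS // andbT.
  apply: contraTN (qB x (mem_belast xq)) => /(subsetP sA).
  by move/(disjointFr disAB)->.
Qed.

Lemma weight_join_split (u : T) :
  weight (A :|: B) (SA :|: SB) u =
  \sum_(v in SA) half_pow (dist (restrict (A :|: B)) (SA :|: SB) u v) +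
  \sum_(v in SB) half_pow (dist (restrict (A :|: B)) (SA :|: SB) u v).
Proof.
rewrite -bigU; first by apply: eq_bigl => v; rewrite !inE.
exact: disjointWl sA (disjointWr sB disAB).
Qed.

Lemma weight_join_own (u : T) : u \in A -> u \notin SA ->
  weight A SA u
  <= \sum_(v in SA) half_pow (dist (restrict (A :|: B)) (SA :|: SB) u v).
Proof.
move=> uA uS; apply: ler_sum => v vS.
rewrite -[X in X <= _]mul1r -[1](expr0 (1 / 2)).
by apply: half_pow_dist_le => p /join_dist_path; exists p; auto.
Qed.

Lemma weight_join (u : T) : u \in A -> u \notin SA ->
  weight A SA u <= weight (A :|: B) (SA :|: SB) u.
Proof.
move=> uA uS; rewrite weight_join_split.
apply: le_trans (weight_join_own uA uS) _.
by rewrite lerDl; apply: sumr_ge0 => v _; apply: half_pow_ge0.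
Qed.

(** The contributions of [SA] and [SB] are bounded separately; those of [SB], measured at [c], are
    delayed by the escape path and the joining edge. *)
Lemma weight_join_cross (u : T) (p : seq T) :
  u \in A -> u \notin SA -> escape A SA u r p ->
  weight A SA u + (1 / 2) ^+ (size p).+1 * weight B SB c
  <= weight (A :|: B) (SA :|: SB) u.
Proof.
move=> uA uS esc; rewrite weight_join_split.
apply: lerD; first exact: weight_join_own.
rewrite mulr_sumr; apply: ler_sum => v vS; apply: half_pow_dist_le => q.
exact: join_dist_path_cross.
Qed.

(** With the two pieces exchanged, this lifts escape paths of the child tree to the root of the
    joined tree. *)
Lemma escape_join (u : T) (p : seq T) :
  escape A SA u r p -> c \notin SB ->
  escape (A :|: B) (SA :|: SB) u c (rcons p c).
Proof.
case/and4P=> Pp /eqP lp Up /allP aS cS.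
apply/and4P; split.
- rewrite rcons_path (path_restrict (subsetUl A B) Pp) lp /=.
  by rewrite /restrict !inE rA cB orbT.
- by rewrite last_rcons.
- rewrite -rcons_cons rcons_uniq Up andbT.
  by apply/negP=> /aS /setDP[cA _]; move: cB; rewrite (disjointFr disAB cA).
- rewrite -rcons_cons all_rcons !inE cB orbT andbT negb_or cS andbT.
  apply/andP; split.
    by apply: contraTN cB => /(subsetP sA) /(disjointFr disAB)->.
  apply/allP=> x /aS /setDP[xA xS].
  by rewrite inE notin_join //= inE xA.
Qed.

Lemma escape_widen (u : T) (p : seq T) :
  escape A SA u r p -> escape (A :|: B) (SA :|: SB) u r p.
Proof.
case/and4P=> Pp lp Up /allP aS; apply/and4P; split=> //.
  exact: (path_restrict (subsetUl A B) Pp).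
by apply/allP=> x /aS /setDP[xA xS]; rewrite inE notin_join //= inE xA.
Qed.

End Join.

(* Weight x arriving from outside at r contributes x / 2 ^ size p at u along an
   escape path p. *)
Definition served (V S : {set T}) (r : T) (n : nat) (u : T) : Prop :=
  1 <= weight V S u \/
  exists2 p, escape V S u r p
    & 1 <= weight V S u + n%:R / 2 * (1 / 2) ^+ size p.

(** A selected root ends no escape path, so in state [Sel] every vertex must be dominated from
    within. *)
Definition achieves (V S : {set T}) (r : T) (a : state) : Prop :=
  match a with
  | Sel => r \in S /\ forall u, u \in V :\: S -> 1 <= weight V S u
  | Uns s n => [/\ r \in V :\: S, s%:R / 2 <= weight V S r
      & forall u, u \in V :\: S -> served V S r n u]
  end.

Lemma achieves_better (V S : {set T}) (r : T) (a b : state) :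
  better a b -> achieves V S r a -> achieves V S r b.
Proof.
case: a b => [|s n] [|s' n'] //= /andP[le_s le_n] [rV le_w H]; split=> //.
  by apply: le_trans le_w; rewrite ler_pM2r // ler_nat.
move=> u /H [w1|[p esc w1]]; [by left | right; exists p => //].
apply: le_trans w1 _; rewrite lerD2l ler_wpM2r ?exprn_ge0 //.
by rewrite ler_pM2r // ler_nat.
Qed.

(** * Soundness of [join_state] *)

Section JoinStates.

Hypothesis e_sym : symmetric e.

Variables (A B SA SB : {set T}) (r c : T).
Hypotheses (disAB : [disjoint A & B]) (sA : SA \subset A) (sB : SB \subset B).
Hypotheses (rA : r \in A) (cB : c \in B) (erc : e r c).

Let disBA : [disjoint B & A]. Proof. by rewrite disjoint_sym. Qed.
Let ecr : e c r. Proof. by rewrite e_sym. Qed.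

Lemma setD_join (u : T) : u \in (A :|: B) :\: (SA :|: SB) ->
  u \in A /\ u \notin SA \/ u \in B /\ u \notin SB.
Proof.
by rewrite !inE negb_or => /andP[/andP[uA uB] /orP[]]; [left | right].
Qed.

Lemma weight_joinr (u : T) : u \in B -> u \notin SB ->
  weight B SB u <= weight (A :|: B) (SA :|: SB) u.
Proof. by rewrite (setUC A) (setUC SA); apply: weight_join. Qed.

Lemma weight_joinr_cross (u : T) (p : seq T) :
  u \in B -> u \notin SB -> escape B SB u c p ->
  weight B SB u + (1 / 2) ^+ (size p).+1 * weight A SA r
  <= weight (A :|: B) (SA :|: SB) u.
Proof. by rewrite (setUC A) (setUC SA); apply: weight_join_cross. Qed.

Lemma escape_joinr (u : T) (p : seq T) :
  escape B SB u c p -> r \notin SA ->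
  escape (A :|: B) (SA :|: SB) u r (rcons p r).
Proof. by rewrite (setUC A) (setUC SA); apply: escape_join. Qed.

Lemma escape_nil (V S : {set T}) (u : T) : u \in V :\: S -> escape V S u u [::].
Proof. by move=> uV; rewrite /escape /= uV eqxx. Qed.

Lemma weight_sel (V S : {set T}) (u : T) : u \in S -> weight V S u = 2.
Proof. exact: exp_weight_in. Qed.

Lemma in_join_root : r \in A :\: SA -> r \in (A :|: B) :\: (SA :|: SB).
Proof.
by case/setDP=> _ rS; rewrite inE (notin_join disAB sB rA rS) inE rA.
Qed.

(** A vertex not yet dominated in its own piece first draws on the other piece along its escape
    path; what is still missing is passed on to the new root. *)
Lemma achieves_join (a b d : state) :
  join_state a b = Some d ->
  achieves A SA r a -> achieves B SB c b ->
  achieves (A :|: B) (SA :|: SB) r d.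
Proof.
have joinl u := @weight_join _ _ _ _ disAB sA sB u.
have crossl u := @weight_join_cross _ _ _ _ _ _ disAB sA sB rA cB erc u.
case: a b => [|s1 n1] [|s2 n2] /=.
- case=> <- [rS HA] [cS HB]; split; first by rewrite inE rS.
  move=> u /setD_join[] [uV uS].
    by apply: le_trans (joinl _ uV uS); rewrite ?HA ?inE ?uS.
  by apply: le_trans (weight_joinr uV uS); rewrite ?HB ?inE ?uS.
- case: ifP => // le_n [<-] [rS HA] [cV wc HB]; split; first by rewrite inE rS.
  move=> u /setD_join[] [uV uS].
    by apply: le_trans (joinl _ uV uS); rewrite ?HA ?inE ?uS.
  have [|w1|[p esc w1]] := HB u; first by rewrite inE uS.
    exact: le_trans w1 (weight_joinr uV uS).
  have := weight_joinr_cross uV uS esc; rewrite (weight_sel _ rS) => w2.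
  (* No demand may remain, so the goal is put in the form of [discount_transfer] with [z = 0]. *)
  suff : 1 <= weight (A :|: B) (SA :|: SB) u + 0 / 2 * (1 / 2) ^+ size p.
    by rewrite !mul0r addr0.
  apply: discount_transfer w1 w2 _.
  by rewrite add0r; move: le_n; rewrite -(ler_nat rat).
- case=> <- [rV wr HA] [cS HB].
  have [_ rS] := setDP rV.
  have w2 := weight_sel B cS.
  split; first exact: in_join_root.
    have := crossl _ _ rA rS (escape_nil rV).
    by rewrite w2 /= expr1 natrD; lra.
  move=> u /setD_join[] [uV uS]; last first.
    by left; apply: le_trans (weight_joinr uV uS); rewrite ?HB ?inE ?uS.
  have [|w1|[p esc w1]] := HA u; first by rewrite inE uS.
    by left; apply: le_trans w1 (joinl _ uV uS).
  right; exists p; first exact: escape_widen.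
  (* Subtraction is truncated, but this inequality is all that the transfer of demand requires. *)
  have : (n1 <= n1 - 2 + 2)%N by rewrite addnC -leq_subLR.
  rewrite -(ler_nat rat) natrD => le_n.
  by apply: discount_transfer w1 (crossl _ _ uV uS esc) _; rewrite w2.
case=> <- [rV wr HA] [cV wc HB].
have [_ rS] := setDP rV.
set n := maxn _ _.
(* Rounding down only understates the weight coming from the child. *)
have : (s2./2 + s2./2 <= s2)%N.
  by rewrite addnn -{2}(odd_double_half s2) leq_addl.
rewrite -(ler_nat rat) natrD => half_s2.
have : (n1 <= n + s2./2)%N by rewrite addnC -leq_subLR leq_maxl.
rewrite -(ler_nat rat) natrD => le_n1.
have : (n2 + n2 <= n + s1)%N.
  by rewrite addnn -mul2n addnC -leq_subLR leq_maxr.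
rewrite -(ler_nat rat) !natrD => le_n2.
split; first exact: in_join_root.
  have := crossl _ _ rA rS (escape_nil rV).
  by rewrite /= expr1 natrD; lra.
move=> u /setD_join[] [uV uS].
  have [|w1|[p esc w1]] := HA u; first by rewrite inE uS.
    by left; apply: le_trans w1 (joinl _ uV uS).
  right; exists p; first exact: escape_widen.
  by apply: discount_transfer w1 (crossl _ _ uV uS esc) _; lra.
have [|w1|[p esc w1]] := HB u; first by rewrite inE uS.
  by left; apply: le_trans w1 (weight_joinr uV uS).
(* The extra edge to [r] halves outside weight, hence the doubled [n2] in the new demand. *)
right; exists (rcons p r); first exact: escape_joinr.
rewrite size_rcons exprS mulrA mul1r.
by apply: discount_transfer w1 (weight_joinr_cross uV uS esc) _; lra.
Qed.

End JoinStates.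

(** * Realized options and rooted spanning trees *)

Definition realizes (V : {set T}) (r : T) (o : state * int) : Prop :=
  exists S : {set T}, [/\ S \subset V, achieves V S r o.1
    & 108 * #|S|%:Z <= 43 * #|V|%:Z + o.2].

(** The tree is present only as an order of assembly; weights are taken in the subgraph induced on
    its vertex set. *)
Inductive rooted_tree : {set T} -> T -> Prop :=
| RootedTree1 r : rooted_tree [set r] r
| RootedTreeU (A B : {set T}) r c of [disjoint A & B] & e r c
    & rooted_tree A r & rooted_tree B c : rooted_tree (A :|: B) r.

Lemma rooted_tree_root (V : {set T}) (r : T) : rooted_tree V r -> r \in V.
Proof. by elim=> [x|A B x y _ _ _ xA _ _]; rewrite !inE ?xA. Qed.

(** The new leaf goes into whichever part contains [u], down to the one-vertex tree at [u]. *)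
Lemma rooted_tree_add (V : {set T}) (r u x : T) :
  rooted_tree V r -> u \in V -> x \notin V -> e u x ->
  rooted_tree (x |: V) r.
Proof.
move=> tV; elim: tV u => {V r} [r|A B r c dis erc tA IHA tB IHB] u.
  rewrite inE => /eqP-> xr erx; rewrite setUC.
  apply: RootedTreeU erx (RootedTree1 _) (RootedTree1 _).
  by rewrite disjoint_sym disjoints1.
rewrite !inE negb_or => uV /andP[xA xB] eux.
case/orP: uV => uV.
  rewrite setUA; apply: RootedTreeU erc _ tB; last exact: IHA eux.
  by rewrite -setI_eq0 setIUl setU_eq0 !setI_eq0 disjoints1 xB.
rewrite setUCA; apply: RootedTreeU erc tA _; last exact: IHB eux.
rewrite -setI_eq0 setIUr setU_eq0 !setI_eq0 dis andbT.
by rewrite disjoint_sym disjoints1 xA.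
Qed.

Lemma connected_rooted_tree (r : T) :
  connected_graph e -> rooted_tree [set: T] r.
Proof.
move=> conn.
suff H k : (k < #|T|)%N -> exists2 V : {set T}, rooted_tree V r & #|V| = k.+1.
  have T0 : (0 < #|T|)%N by apply/card_gt0P; exists r.
  have [|V tV cV] := H #|T|.-1; first by rewrite prednK.
  suff <- : V = [set: T] by [].
  by apply/eqP; rewrite eqEcard subsetT cardsT cV leqSpred.
elim: k => [|k IH] kT.
  by exists [set r]; [apply: RootedTree1 | rewrite cards1].
have [V tV cV] := IH (ltnW kT).
have rV := rooted_tree_root tV.
have [x xV] : exists x, x \notin V.
  apply/existsP; apply: contraTT kT => /existsPn VT; rewrite -leqNgt -cV.
  by apply/subset_leq_card/subsetP=> y _; have := VT y; rewrite negbK.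
have [/existsP[u /existsP[y /and3P[uV yV euy]]]|noedge] :=
    boolP [exists u, exists y, [&& u \in V, y \notin V & e u y]].
  exists (y |: V); first exact: (rooted_tree_add tV uV yV euy).
  by rewrite cardsU1 yV cV.
(* If no edge leaves [V], a path from [r] to [x] never leaves [V], although [x] lies outside. *)
have /connectP[p Pp lp] := conn r x; case/negP: xV; rewrite {}lp.
elim: p r rV Pp {tV IH} => //= y p IHp u uV /andP[euy /IHp]; apply.
apply: contraNT noedge => yV; apply/existsP; exists u.
by apply/existsP; exists y; rewrite uV yV.
Qed.

(** * From rooted trees to the bound *)

Lemma realizes_join (A B : {set T}) (r c : T) (o1 o2 : state * int)
    (d : state) :
  symmetric e -> [disjoint A & B] -> r \in A -> c \in B -> e r c ->
  realizes A r o1 -> realizes B c o2 -> join_state o1.1 o2.1 = Some d ->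
  realizes (A :|: B) r (d, o1.2 + o2.2).
Proof.
move=> e_sym dis rA cB erc [SA [sA HA kA]] [SB [sB HB kB]] ed.
exists (SA :|: SB); split; first exact: setUSS.
  exact: achieves_join ed HA HB.
have disS : [disjoint SA & SB] := disjointWl sA (disjointWr sB dis).
rewrite !cardsU (disjoint_setI0 dis) (disjoint_setI0 disS) !cards0 !subn0 /=.
by move: kA kB; lia.
Qed.


Lemma realizes_le (V : {set T}) (r : T) (o o' : state * int) :
  option_le o o' -> realizes V r o -> realizes V r o'.
Proof.
case/andP=> le_a le_k [S [sS HS kS]]; exists S; split=> //.
  exact: achieves_better HS.
by rewrite (le_trans kS) // lerD2l.
Qed.

Lemma realizes_point (r : T) (o : state * int) :
  o \in point_profile -> realizes [set r] r o.
Proof.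
rewrite !inE => /orP[] /eqP->.
  exists [set r]; split=> //; last by rewrite cards1.
  by split=> [|u]; rewrite ?set11 // setDv inE.
exists set0; split; rewrite ?sub0set ?cards0 ?cards1 //.
split; rewrite ?setD0 ?set11 ?mul0r ?weight_ge0 // => u /set1P->.
right; exists [::]; first by rewrite /escape /= setD0 set11 eqxx.
by rewrite expr0 mulr1 divff // lerDr weight_ge0.
Qed.

(** Induction on the assembly: each option of the profile [R] chosen by [profiles_closed] is a
    weakening of a join of options of the two parts. *)
Lemma rooted_tree_profile (V : {set T}) (r : T) :
  symmetric e -> rooted_tree V r ->
  exists2 P, P \in profiles & forall o, o \in P -> realizes V r o.
Proof.
move=> e_sym; elim=> {V r} [r|A B r c dis erc tA [P PW HP] tB [Q QW HQ]].
  by exists point_profile; [rewrite inE eqxx | apply: realizes_point].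
have /hasP[R RW /allP leR] := allP (allP profiles_closed P PW) Q QW.
exists R => // o /leR /hasP[o' + le_o]; rewrite mem_pmap.
case/mapP=> -[o1 o2] /allpairsP[[x y] /= [xP yQ [-> ->]]] eq_o.
apply: realizes_le le_o _; move: eq_o; rewrite /join_option /=.
case ed: join_state => [d|] //= -[->].
by apply: realizes_join (HP _ xP) (HQ _ yQ) ed; rewrite ?rooted_tree_root.
Qed.

Lemma restrictT : restrict [set: T] =2 e.
Proof. by move=> x y; rewrite /restrict !inE. Qed.

Lemma weightT (S : {set T}) (u : T) : weight [set: T] S u = exp_weight e S u.
Proof.
apply: eq_bigr => v _; congr half_pow; rewrite /dist; congr ohead.
apply: eq_filter => k; apply: eq_existsb => p; rewrite /dist_path.
by rewrite (eq_path restrictT).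
Qed.

(** With zero demand at the root, both alternatives of [served] give weight at least 1. *)
Lemma dominating_realizes (r : T) (o : state * int) :
  dominating_option o -> realizes [set: T] r o ->
  exists2 S : {set T}, exp_dominating e S & 108 * #|S|%:Z <= 43 * #|T|%:Z + 86.
Proof.
case: o => a k /andP[/= a0 k86] [S [_ HS kS]]; exists S; last first.
  by rewrite -cardsT (le_trans kS) // lerD2l.
apply/forallP=> u; rewrite -weightT.
have [uS|uS] := boolP (u \in S); first by rewrite weight_sel.
have uD : u \in [set: T] :\: S by rewrite !inE uS.
case: a a0 HS {kS} => [_ [_ /(_ u uD)] //|s n /eqP-> [_ _ /(_ u uD)]].
by case=> // -[p _]; rewrite !mul0r addr0.
Qed.

End Restriction.

Theorem theorem4 (T : finType) (e : rel T)
    (e_sym : symmetric e) (e_irr : irreflexive e)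
    (e_conn : connected_graph e) :
  (exp_dom_number e)%:R <= 43 / 108 * (#|T|%:R + 2) :> rat.
Proof.
have [S0 cS0] := exp_dom_numberP e.
have [T0|[r _]] := set_0Vmem [set: T].
  (* The empty graph has no vertex to serve as root; its exponential domination number is 0. *)
  case: S0 => S _ <-; have -> : S = set0.
    by apply/eqP; rewrite -subset0 -T0 subsetT.
  rewrite cards0 mulr0n; have := ler0n rat #|T|.
  by move: (#|T|%:R : rat) => y; lra.
have [P PW HP] := rooted_tree_profile e_sym (connected_rooted_tree r e_conn).
have /hasP[o oP o_dom] := allP profiles_final P PW.
have [S /cS0 leS kS] := dominating_realizes o_dom (HP o oP).
have : (108 * exp_dom_number e <= 43 * #|T| + 86)%N by lia.
rewrite -(ler_nat rat) natrD !natrM.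
by move: (exp_dom_number e)%:R (#|T|%:R : rat) => x y; lra.
Qed.
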